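(* Let $G=(V,E)$ be a finite multigraph and let $t\colon V\to\mathbb{N}$ be a function. Then $$\chi_{\mathrm{OL}}^t(G)\,\leq\,\max_{uv\in E}\Bigl(\max(d(u),d(v))+\bigl\lfloor\tfrac{1}{2}\min(d(u),d(v))\bigr\rfloor+t(u)+t(v)\Bigr).$$ In particular, if $t$ is constant, then $$\chi_{\mathrm{OL}}^t(G)\,\leq\,\bigl\lfloor\tfrac{3}{2}\Delta(G)\bigr\rfloor+2t.$$
   Context: $\mathbb{N}=\{0,1,2,\dots\}$. A multigraph $G=(V,E)$ may have several parallel edges between two vertices, but every edge $uv=\{u,v\}$ has two distinct ends (no loops). $d(v)$ is the degree of the vertex $v$ (number of edges incident with $v$, counted with multiplicity) and $\Delta(G)$ is the maximal degree. For $t\colon V\to\mathbb{N}$ let $\operatorname{supp}(t)=\{v\in V : t(v)\neq0\}$; for $U\subseteq V$ let $\mathsf{1}_U\colon V\to\{0,1\}$ be the indicator function of $U$. A constant function $t$ is identified with its value. A set of edges is independent if its members are pairwise disjoint (no two share an end). $G-U$ is the multigraph obtained by deleting the vertices in $U$ and all edges incident with them; $G-F$ is obtained by deleting the edges in $F$ (keeping all vertices). For $m\in\mathbb{N}$, being on-line $t$-avoiding edge $m$-colorable is defined recursively: (i) if $m=0$, then $G$ is on-line $t$-avoiding edge $m$-colorable if $E=\emptyset$; (ii) if $m>0$, then $G$ is on-line $t$-avoiding edge $m$-colorable if for every subset $U\subseteq\operatorname{supp}(t)$ there exists an independent subset $F\subseteq E(G-U)$ such that $G-F$ is on-line $(t-\mathsf{1}_U)$-avoiding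 edge $(m-1)$-colorable. The on-line $t$-avoiding chromatic index $\chi_{\mathrm{OL}}^t(G)$ is the smallest $m\in\mathbb{N}$ such that $G$ is on-line $t$-avoiding edge $m$-colorable. The maximum over an empty edge set is taken to be $0$. *)

(* Defs.v *)
From mathcomp Require Import all_boot.

Set Implicit Arguments.
Unset Strict Implicit.
Unset Printing Implicit Defensive.

(* The vertices are all the elements of V; the elements of E are only labels,  *)
(* and the edges are those in [edges].  Distinct labels may have the same      *)
(* ends (parallel edges); having exactly two ends excludes loops.              *)
Record multigraph (V E : finType) := Multigraph {
  edges : {set E};
  ends : E -> {set V};
  card_ends : forall e, e \in edges -> #|ends e| = 2
}.

Section Multigraph.
Variables V E : finType.
Implicit Types (G : multigraph V E) (F : {set E}) (U : {set V}) (t : V -> nat).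

Definition degree G (v : V) : nat := #|[set e in edges G | v \in ends G e]|.

Definition max_degree G : nat := \max_(v : V) degree G v.

Definition adjacent G (u v : V) : bool :=
  [exists e in edges G, ends G e == [set u; v]].

Definition independent G F : bool :=
  [forall e in F, forall f in F,
    (e != f) ==> [disjoint ends G e & ends G f]].

(* E(G - U) *)
Definition edges_minus_vertices G U : {set E} :=
  [set e in edges G | [disjoint ends G e & U]].

Lemma card_ends_minus G F e : e \in edges G :\: F -> #|ends G e| = 2.
Proof. by case/setDP => /card_ends. Qed.

(* G - F *)
Definition minus_edges G F : multigraph V E :=
  Multigraph (@card_ends_minus G F).

Definition supp t : {set V} := [set v | t v != 0].

Fixpoint online_colorable (m : nat) G t : bool :=
  if m is m'.+1 then
    [forall U : {set V}, (U \subset supp t) ==>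
      [exists F : {set E},
        [&& F \subset edges_minus_vertices G U, independent G F
          & online_colorable m' (minus_edges G F)
              (fun v => t v - (v \in U))]]]
  else edges G == set0.

Lemma online_colorable_large m G t :
  #|edges G| + \sum_v t v <= m -> online_colorable m G t.
Proof.
elim: m G t => [|m IHm] G t /=.
  by rewrite leqn0 addn_eq0 cards_eq0 => /andP[].
move=> le_m; apply/forallP=> U; apply/implyP=> sUt; apply/existsP.
have [U0 | [v vU]] := set_0Vmem U; last first.
  exists set0; apply/and3P; split; first exact: sub0set.
    by apply/forall_inP=> e; rewrite inE.
  apply: IHm; rewrite /= setD0 -ltnS; apply: leq_trans le_m.
  have tv : 0 < t v by move/subsetP: sUt => /(_ v vU); rewrite inE lt0n.
  rewrite ltn_add2l (bigD1 v) //= [X in _ < X](bigD1 v) //= vU.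
  rewrite -addSn leq_add //; first by rewrite subn1 prednK.
  by apply: leq_sum => w _; apply: leq_subr.
have [E0 | [e eG]] := set_0Vmem (edges G).
  exists set0; apply/and3P; split; first exact: sub0set.
    by apply/forall_inP=> e; rewrite inE.
  have {}IHm: forall n G' t', edges G' = set0 -> online_colorable n G' t'.
    elim=> [|n IHn] G' t' E'0 /=; first by rewrite E'0.
    apply/forallP=> U'; apply/implyP=> _; apply/existsP; exists set0.
    apply/and3P; split; first exact: sub0set.
      by apply/forall_inP=> e; rewrite inE.
    by apply: IHn; rewrite /= setD0.
  by apply: IHm; rewrite /= setD0.
exists [set e]; apply/and3P; split.
- by rewrite sub1set inE eG U0 disjoint_sym disjoints_subset sub0set.
- apply/forall_inP=> f /set1P->; apply/forall_inP=> g /set1P->.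
  by rewrite eqxx.
apply: IHm; rewrite /= -ltnS; apply: leq_trans le_m.
rewrite [#|edges G|](cardsD1 e) eG add1n addSn ltnS leq_add2l.
by apply: leq_sum => w _; apply: leq_subr.
Qed.

Lemma online_colorable_ex G t : exists m, online_colorable m G t.
Proof. by eexists; apply: online_colorable_large. Qed.

Definition online_chromatic_index G t : nat :=
  ex_minn (online_colorable_ex G t).

End Multigraph.

(* Main.v *)
(* The proof follows Borodin, Kostochka and Woodall.  If every subset of the
   edges has a kernel with respect to a relation on edges, then the strategy of
   always answering with a kernel of the still available edges succeeds: in each
   round an edge that survives loses either an out-neighbour or a unit of [t] at
   one of its ends.  In a bipartite multigraph stable matchings are kernels, and
   the preferences can be chosen such that every edge [uv] has out-degree less
   than [max(d(u), d(v))]; by Hall's theorem they are built up by repeatedly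
   removing a suitable matching around vertices of maximal degree.  In general,
   a maximum cut splits [G] into a bipartite [G2] and a rest [G1] that has at
   every vertex at most half of the degree.  The two are coloured in parallel:
   the edges chosen in [G1], found by induction, make their ends unavailable in
   [G2], so that the latter is played with [t + d_(G1)] in place of [t]. *)

Require Import Defs.
From mathcomp Require Import all_boot.
From mathcomp Require Import zify.

Set Implicit Arguments.
Unset Strict Implicit.

(** * Hall's marriage theorem *)

Section Hall.
Variables T T' : finType.
Implicit Types (N : T -> {set T'}) (A B C : {set T}).

(** Induction on [#|A|]. If some nonempty proper subset is tight, it is matched first and the rest
    avoids its neighbours; otherwise any [x] may take any neighbour. [y0] only supplies a value when
    [A] is empty. *)
Lemma hall_matching N A (y0 : T') :
  (forall B, B \subset A -> #|B| <= #|\bigcup_(x in B) N x|) ->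
  exists f : T -> T',
    {in A, forall x, f x \in N x} /\ {in A &, injective f}.
Proof.
have [n] := ubnP #|A|; elim: n => // n IHn in N A * => /ltnSE leAn hallA.
have [A0 | [x xA]] := set_0Vmem A.
  by exists (fun=> y0); split=> [x | x y]; rewrite A0 inE.
pose tight B :=
  [&& B \proper A, B != set0 & #|\bigcup_(x in B) N x| <= #|B|].
case: (pickP tight) => [B /and3P[pBA B_n0 NB_le] | no_tight].
  have sBA := proper_sub pBA.
  have [|B' sB'B|f [fN f_inj]] := IHn N B.
  - exact: leq_trans (proper_card pBA) leAn.
  - exact/hallA/(subset_trans sB'B).
  pose NB := \bigcup_(x in B) N x.
  have [||g [gN g_inj]] := IHn (fun x => N x :\: NB) (A :\: B).
  - apply: leq_trans leAn; rewrite cardsDS // -card_gt0 in B_n0 *.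
    have := subset_leq_card sBA; lia.
  - move=> C sC; have /subsetDP[sCA dCB] := sC.
    have -> : \bigcup_(z in C) (N z :\: NB) = (\bigcup_(z in C) N z) :\: NB.
      by rewrite setDE big_distrl /=; apply: eq_bigr => z _; rewrite setDE.
    (* Together [C] and [B] have at least [#|C| + #|B|] neighbours, of which at most [#|B|] lie in
       [NB]. *)
    have := hallA (C :|: B); rewrite subUset sCA sBA => /(_ isT).
    rewrite bigcup_setU cardsU (disjoint_setI0 dCB) cards0 -/NB.
    rewrite -(cardsID NB (_ :|: NB)) setDUl setDv setU0.
    rewrite setIC setIUr setIid (setUidPr (subsetIl _ _)).
    by move: NB_le; rewrite -/NB; lia.
  exists (fun z => if z \in B then f z else g z); split=> [z zA | y z yA zA].
    case: ifP => zB; first exact: fN.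
    by have := gN z; rewrite !inE zB zA => /(_ isT) /andP[].
  have g_notin w : w \in A -> w \notin B -> g w \notin NB.
    by move=> wA wB; have := gN w; rewrite !inE wB wA => /(_ isT) /andP[].
  have f_in w : w \in B -> f w \in NB.
    by move=> wB; apply/bigcupP; exists w => //; apply: fN.
  case: ifPn => yB; case: ifPn => zB; first exact: f_inj.
  - by move=> e; have := g_notin z zA zB; rewrite -e f_in.
  - by move=> e; have := g_notin y yA yB; rewrite e f_in.
  by apply: g_inj; rewrite inE ?yB ?zB.
have [w wN] : exists w, w \in N x.
  apply/set0Pn; have := hallA [set x]; rewrite sub1set xA => /(_ isT).
  by rewrite big_set1 cards1 card_gt0.
have [||f [fN f_inj]] := IHn (fun z => N z :\ w) (A :\ x).
- by rewrite (cardsD1 x) xA in leAn.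
- move=> C sC.
  have -> : \bigcup_(z in C) (N z :\ w) = (\bigcup_(z in C) N z) :\ w.
    by rewrite setDE big_distrl /=; apply: eq_bigr => z _; rewrite setDE.
  have [->|C_n0] := eqVneq C set0; first by rewrite cards0.
  (* As a nonempty proper subset of [A], [C] is not tight; its spare neighbour makes up for the loss
     of [w]. *)
  have := no_tight C; rewrite /tight C_n0 (sub_proper_trans sC (properD1 xA)).
  move=> /= /negbT; rewrite -ltnNge.
  by rewrite (cardsD1 w (\bigcup_(z in C) N z)); lia.
exists (fun z => if z == x then w else f z); split=> [z zA | y z yA zA].
  case: eqP => [->// | /eqP zx]; have := fN z.
  by rewrite !inE zx zA => /(_ isT) /andP[].
have fNw u : u \in A -> u != x -> f u != w.
  by move=> uA ux; have := fN u; rewrite !inE ux uA => /(_ isT) /andP[].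
case: (eqVneq y x) => [->|yx]; case: (eqVneq z x) => [->|zx] // e.
- by have := fNw z zA zx; rewrite e eqxx.
- by have := fNw y yA yx; rewrite e eqxx.
by apply: f_inj; rewrite ?inE ?yx ?zx.
Qed.

End Hall.

Section Galvin.
Variables V E : finType.
Implicit Types (G : multigraph V E) (F S M : {set E}) (X U Z : {set V}).
Implicit Types (t : V -> nat) (c : E -> nat).

(** * Covered vertices and bipartitions *)

Definition covered G F : {set V} := \bigcup_(f in F) ends G f.

Lemma independentP G F :
  reflect {in F &, forall e f v, v \in ends G e -> v \in ends G f -> e = f}
          (independent G F).
Proof.
apply: (iffP forall_inP) => [indF e f eF fF v ve vf | indF e eF].
  have [//|nef] := eqVneq e f; have /forall_inP/(_ f fF) := indF e eF.
  by rewrite nef => /pred0P/(_ v) /=; rewrite ve vf.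
apply/forall_inP=> f fF; apply/implyP; apply: contraNT => /pred0Pn[v].
by case/andP=> ve vf; apply/eqP/(indF e f eF fF v).
Qed.

Lemma degree_minus G F v : F \subset edges G -> independent G F ->
  degree G v = degree (minus_edges G F) v + (v \in covered G F).
Proof.
move=> sF /independentP indF.
rewrite /degree -(cardsID F [set e in edges G | _]) addnC; congr (_ + _).
  by apply: eq_card => e; rewrite !inE /= -andbA.
have [/bigcupP[f fF vf] | nv] := boolP (v \in covered G F).
  apply/eqP/cards1P; exists f; apply/setP=> e; rewrite !inE.
  apply/idP/eqP => [/andP[/andP[_ ve] eF] | ->].
    exact: (indF e f eF fF v).
  by rewrite (subsetP sF) ?vf.
apply/eqP; rewrite cards_eq0 -subset0; apply/subsetP=> f; rewrite !inE.
case/andP=> /andP[_ vf] fF; case/negP: nv.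
by apply/bigcupP; exists f.
Qed.

(** Edges have two ends, so odd means one end on each side. The parity form agrees with [cut], where
    moving a vertex across becomes an exclusive or. *)
Definition bipartite X G : Prop :=
  {in edges G, forall e, odd #|ends G e :&: X|}.

Lemma odd_card_pair (u v : V) X :
  u != v -> odd #|[set u; v] :&: X| = (u \in X) (+) (v \in X).
Proof.
rewrite eq_sym => vu; rewrite (cardsD1 u) (cardsD1 v) !inE !eqxx vu orbT /=.
rewrite (_ : _ :\ v = set0) ?cards0; last first.
  by apply/setP=> w; rewrite !inE; case: (w == u); case: (w == v).
by rewrite addn0 oddD; do 2!case: (_ \in X).
Qed.

Lemma bipartite_ends X G e : bipartite X G -> e \in edges G ->
  exists x y, [/\ ends G e = [set x; y], x \in X & y \notin X].
Proof.
move=> bipG eG; have /eqP/cards2P[x [y [xy defe]]] := card_ends eG.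
have := bipG e eG; rewrite defe odd_card_pair //.
case xX: (x \in X); case yX: (y \in X) => // _; first by exists x, y; rewrite yX.
by exists y, x; rewrite setUC xX.
Qed.

Lemma bipartite_end_uniq X G e u v : bipartite X G -> e \in edges G ->
  u \in ends G e -> v \in ends G e -> (u \in X) = (v \in X) -> u = v.
Proof.
move=> bipG eG; have [x [y [-> xX yX]]] := bipartite_ends bipG eG.
rewrite !inE => /orP[]/eqP-> /orP[]/eqP-> //.
  by rewrite xX (negPf yX).
by rewrite xX (negPf yX).
Qed.

Lemma bipartiteC X G : bipartite X G -> bipartite (~: X) G.
Proof.
move=> bipG e eG; have [x [y [-> xX yX]]] := bipartite_ends bipG eG.
have xy: x != y by apply: contraNneq yX => <-.
by rewrite odd_card_pair // !inE xX yX.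
Qed.

Lemma bipartite_minus X G F : bipartite X G -> bipartite X (minus_edges G F).
Proof. by move=> bipG e /setDP[/bipG]. Qed.

(** * Stable matchings *)

(* The vertices in [X] prefer large values of [c], the others small ones. *)
Definition dominates G X c (f e : E) : bool :=
  [exists v in ends G e :&: ends G f, if v \in X then c e < c f else c f < c e].

Definition proper_coloring G c : Prop :=
  {in edges G &, forall e f v, v \in ends G e -> v \in ends G f ->
     c e = c f -> e = f}.

(** Arcs point from an edge to the edges dominating it, so a kernel contains an out-neighbour of
    every edge outside it. *)
Definition outdegree G X c e : nat := #|[set f in edges G | dominates G X c f e]|.

(** Deferred acceptance with one refusal at a time: the vertices of [X] propose their favourite
    edges. If two proposals collide, necessarily outside [X], the refused edge is deleted; otherwise
    the proposals form the kernel. *)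
Lemma stable_matching X G c S : bipartite X G -> proper_coloring G c ->
  S \subset edges G ->
  exists F, [/\ F \subset S, independent G F
    & {in S :\: F, forall e, exists2 f, f \in F & dominates G X c f e}].
Proof.
move=> bipG c_proper; have [n] := ubnP #|S|.
elim: n => // n IHn in S * => /ltnSE leSn sSG.
have memG e : e \in S -> e \in edges G by apply: (subsetP sSG).
pose best e := [forall g in S, forall x in X :&: ends G e :&: ends G g, c g <= c e].
have bestP e g x : best e -> g \in S -> x \in X -> x \in ends G e ->
    x \in ends G g -> c g <= c e.
  move=> /forall_inP/(_ g) bg gS xX xe xg.
  by have /forall_inP/(_ x) := bg gS; rewrite !inE xX xe xg; apply.
pose T := [set e in S | best e].
have [indT | depT] := boolP (independent G T).
  exists T; split=> // [|e]; first by apply/subsetP=> e /setIdP[].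
  case/setDP=> eS; rewrite inE eS /=.
  case/forall_inPn=> g gS /forall_inPn[x]; rewrite !inE -andbA -ltnNge.
  case/and3P=> xX xe xg lt_eg.
  pose P h := (h \in S) && (x \in ends G h).
  have Pg : P g by rewrite /P gS.
  case: (arg_maxnP c Pg) => h /andP[hS xh] h_max.
  exists h; last first.
    apply/exists_inP; exists x; first by rewrite inE xe.
    by rewrite xX; apply: leq_trans lt_eg (h_max g Pg).
  rewrite inE hS /=; apply/forall_inP=> k kS; apply/forall_inP=> y.
  rewrite !inE -andbA => /and3P[yX yh yk].
  suff eyx : y = x by apply: h_max; rewrite /P kS -eyx.
  by apply: (bipartite_end_uniq bipG (memG h hS)); rewrite // yX xX.
have [e [f [v [[eS fS fbest] [ve vf] vX lt_fe]]]] : exists e f v,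
    [/\ [/\ e \in S, f \in S & best f], v \in ends G e /\ v \in ends G f,
        v \notin X & c f < c e].
  case/forall_inPn: depT => e /setIdP[eS ebest] /forall_inPn[f /setIdP[fS fbest]].
  rewrite negb_imply => /andP[nef /pred0Pn[v /andP[/= ve vf]]].
  have ncef : c e != c f.
    by apply: contraNneq nef => /(c_proper e f _ _ v)->; rewrite ?memG.
  have vX : v \notin X.
    apply: contraNN ncef => vX; rewrite eqn_leq.
    by rewrite (bestP f e v) // (bestP e f v).
  move: ncef; rewrite neq_ltn => /orP[lt|lt]; first by exists f, e, v.
  by exists e, f, v.
have [||F [sF indF domF]] := IHn (S :\ e).
- by rewrite (cardsD1 e) eS in leSn.
- exact: subset_trans (subD1set _ _) sSG.
have sFS := subset_trans sF (subD1set _ _).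
exists F; split=> // e'; rewrite inE => /andP[e'F e'S].
have [->|ne] := eqVneq e' e; last by apply: domF; rewrite !inE e'F ne.
have dom_v g : v \in ends G g -> c g < c e -> dominates G X c g e.
  move=> vg lt_ge; apply/exists_inP; exists v; first by rewrite inE ve.
  by rewrite (negPf vX).
have [fF|fF] := boolP (f \in F); first by exists f => //; apply: dom_v.
(* Some [g] in [F] dominates [f]. As [f] is best at its end in [X], this happens at [v], so [g]
   dominates [e] there too. *)
have [|g gF] := domF f.
  by rewrite !inE fF fS andbT; apply: contraTneq lt_fe => ->; rewrite ltnn.
case/exists_inP=> w /setIP[wf wg]; have gS := subsetP sFS _ gF.
case: ifPn => wX lt_fg.
  by have := bestP f g w fbest gS wX wf wg; rewrite leqNgt lt_fg.
have eq_wv : w = v.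
  by apply: (bipartite_end_uniq bipG (memG f fS)); rewrite // (negPf wX) (negPf vX).
exists g => //; apply: dom_v; first by rewrite -eq_wv.
exact: ltn_trans lt_fe.
Qed.

(** * On-line colouring by kernels *)

Lemma kernel_perfect_colorable (dom : rel E) m G t :
  (forall S, S \subset edges G -> exists F, [/\ F \subset S, independent G F
     & {in S :\: F, forall e, exists2 f, f \in F & dom f e}]) ->
  {in edges G, forall e,
     #|[set f in edges G | dom f e]| + \sum_(v in ends G e) t v < m} ->
  online_colorable m G t.
Proof.
elim: m G t => [|m IHm] G t kerG boundG /=.
  by apply/eqP/setP=> e; rewrite inE; apply/negP => /boundG.
apply/forall_inP=> U sUt.
have sS : edges_minus_vertices G U \subset edges G.
  by apply/subsetP=> e /setIdP[].
have [F [sF indF domF]] := kerG _ sS.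
apply/existsP; exists F; rewrite sF indF /=.
have sFG := subset_trans sF sS.
apply: IHm => [S sSG | e /setDP[eG eF]] /=.
  by apply: kerG; apply: subset_trans sSG (subsetDl _ _).
have /ltnSE := boundG e eG; apply: leq_trans.
have sout : [set f in edges G :\: F | dom f e] \subset [set f in edges G | dom f e].
  by apply/subsetP=> f; rewrite !inE -andbA => /and3P[_ -> ->].
have [dis | /pred0Pn[u /andP[/= ue uU]]] := boolP [disjoint ends G e & U].
  have [|f fF fe] := domF e; first by rewrite !inE eF eG.
  rewrite -addSn leq_add //; last by apply: leq_sum => v _; apply: leq_subr.
  apply: proper_card; rewrite properE sout /=; apply/subsetPn; exists f.
    by rewrite inE (subsetP sFG).
  by rewrite !inE fF.
(* Since [u] lies in [supp t], the truncated subtraction really lowers [t u]. *)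
rewrite -addnS leq_add ?subset_leq_card //.
rewrite (bigD1 u) //= [leqRHS](bigD1 u) //= uU -addSn leq_add //.
  by have := subsetP sUt u uU; rewrite inE -lt0n subn1 => /prednK->.
by apply: leq_sum => v _; apply: leq_subr.
Qed.

(** * Matchings around vertices of maximal degree *)

(* In the preferences of [dominates], [M] may be placed last at every vertex of
   [X] and first at every other vertex without spoiling the bound. *)
Definition removable X G M : Prop :=
  [/\ M \subset edges G, M != set0, independent G M
    & forall v, v \in covered G M -> v \notin X ->
      {in edges G, forall e u, v \in ends G e -> u \in ends G e -> u \in X ->
         u \in covered G M \/ degree G u < degree G v}].

Lemma adjacent_edge G e u v : e \in edges G -> u \in ends G e ->
  v \in ends G e -> u != v -> adjacent G u v.
Proof.
move=> eG ue ve uv; apply/exists_inP; exists e => //.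
by rewrite eq_sym eqEcard subUset !sub1set ue ve cards2 uv card_ends.
Qed.

Definition max_vertices G : {set V} := [set v | degree G v == max_degree G].

Definition max_neighbors G (v : V) : {set V} :=
  [set u in max_vertices G | adjacent G v u].

Lemma lt_max_degree G u : u \notin max_vertices G -> degree G u < max_degree G.
Proof. by rewrite inE ltn_neqAle => ->; apply: leq_bigmax. Qed.

Lemma degree_gt0 G e u : e \in edges G -> u \in ends G e -> 0 < degree G u.
Proof. by move=> eG ue; apply/card_gt0P; exists e; rewrite inE eG. Qed.

(** At a matched vertex outside [X], chosen of maximal degree, every neighbour of maximal degree is
    matched too and every other neighbour has smaller degree, as [removable] demands. *)
Lemma removable_of_hall X G Z0 : bipartite X G -> edges G != set0 ->
  Z0 \subset max_vertices G :\: X -> Z0 != set0 ->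
  #|\bigcup_(z in Z0) max_neighbors G z| <= #|Z0| ->
  exists M, removable X G M.
Proof.
move=> bipG /set0Pn[e0 e0G] sZ0 Z0_n0 leN0.
have max_gt0 : 0 < max_degree G.
  have [x [y [def0 _ _]]] := bipartite_ends bipG e0G.
  apply: leq_trans (leq_bigmax x); apply: (degree_gt0 e0G).
  by rewrite def0 !inE eqxx.
pose tight Z := [&& Z \subset max_vertices G :\: X, Z != set0
  & #|\bigcup_(z in Z) max_neighbors G z| <= #|Z|].
have tightZ0 : tight Z0 by apply/and3P.
(* A smallest tight set satisfies Hall's condition, and the matching then covers
   all its neighbours of maximal degree. *)
case: (arg_minnP (fun Z => #|Z|) tightZ0) => Z /and3P[sZ Z_n0 leN] minZ.
have ZX z : z \in Z -> (z \notin X) * (degree G z = max_degree G).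
  by move=> /(subsetP sZ); rewrite !inE => /andP[-> /eqP].
have nbrX z u : z \in Z -> u \in max_neighbors G z -> u \in X.
  move=> zZ; rewrite inE => /andP[_ /exists_inP[e eG /eqP dee]].
  have [x [y [de xX yX]]] := bipartite_ends bipG eG.
  move: xX; have: x \in ends G e by rewrite de !inE eqxx.
  by rewrite dee !inE => /orP[]/eqP-> //; rewrite (negPf (ZX z zZ).1).
have endX e v u : e \in edges G -> v \in ends G e -> u \in ends G e ->
    v \notin X -> u \in X -> u \notin max_vertices G \/ u \in max_neighbors G v.
  move=> eG ve ue vX uX; have [uD | ] := boolP (u \in max_vertices G); last by left.
  right; rewrite inE uD (adjacent_edge eG) //.
  by apply: contraNneq vX => ->.
(* A vertex of [Z] with no neighbour of maximal degree has only neighbours of smaller degree, so any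
   single edge at it will do. *)
have [isolated | /exists_inPn nonisolated] :=
    boolP [exists z in Z, max_neighbors G z == set0].
  have [z zZ /eqP Nz] := exists_inP isolated.
  have /card_gt0P[e] : 0 < degree G z by rewrite (ZX z zZ).2.
  rewrite inE => /andP[eG ze]; exists [set e]; split.
  - by rewrite sub1set.
  - by apply/set0Pn; exists e; rewrite inE.
  - by apply/independentP=> f g /set1P-> /set1P->.
  move=> v; rewrite /covered big_set1 => ve vX f fG u vf uf uX; right.
  have eq_vz : v = z.
    apply: (bipartite_end_uniq bipG eG) => //.
    by rewrite (negPf vX) (negPf (ZX z zZ).1).
  rewrite eq_vz (ZX z zZ).2; apply: lt_max_degree.
  by case: (endX f v u) => //; rewrite eq_vz Nz inE.
have [z0 z0Z] := set0Pn _ Z_n0.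
have hallZ (B : {set V}) : B \subset Z -> #|B| <= #|\bigcup_(x in B) max_neighbors G x|.
  have strict (C : {set V}) : C \proper Z -> C != set0 ->
      #|C| < #|\bigcup_(x in C) max_neighbors G x|.
    move=> pC C_n0; rewrite ltnNge; apply: contraTN (proper_card pC) => leC.
    rewrite -leqNgt; apply: minZ; rewrite /tight C_n0 leC.
    by rewrite (subset_trans (proper_sub pC) sZ).
  have [->|B_n0] := eqVneq B set0; first by rewrite cards0.
  rewrite subEproper => /predU1P[->|pB]; last exact/ltnW/strict.
  (* For [Z] itself the bound comes from the strict expansion of [Z :\ z0]; a singleton [Z] needs
     [nonisolated]. *)
  rewrite (cardsD1 z0) z0Z; have [Z10|Z1_n0] := eqVneq (Z :\ z0) set0.
    rewrite Z10 cards0 card_gt0.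
    have /set0Pn[u uN] := nonisolated z0 z0Z.
    by apply/set0Pn; exists u; apply/bigcupP; exists z0.
  apply: leq_trans (strict _ (properD1 z0Z) Z1_n0) _.
  apply/subset_leq_card/bigcupsP=> z /setD1P[_ zZ].
  exact: (bigcup_sup z zZ).
have [f [fN f_inj]] := hall_matching z0 hallZ.
have imf : f @: Z = \bigcup_(z in Z) max_neighbors G z.
  apply/eqP; rewrite eqEcard card_in_imset // leN andbT.
  by apply/subsetP=> _ /imsetP[z zZ ->]; apply/bigcupP; exists z; rewrite ?fN.
have /fin_all_exists[g g_edge] : forall z, exists e,
    z \in Z -> e \in edges G /\ ends G e = [set z; f z].
  move=> z; have [zZ|] := boolP (z \in Z); last by exists e0.
  have := fN z zZ; rewrite inE => /andP[_ /exists_inP[e eG /eqP]].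
  by exists e.
exists (g @: Z).
have coveredP v : v \in covered G (g @: Z) -> exists2 z, z \in Z & v = z \/ v = f z.
  case/bigcupP=> _ /imsetP[z zZ ->]; rewrite (g_edge z zZ).2 !inE.
  by move=> /orP[]/eqP->; exists z; auto.
have fX z : z \in Z -> f z \in X by move=> zZ; apply/(nbrX z)/fN.
split.
- by apply/subsetP=> _ /imsetP[z zZ ->]; case: (g_edge z zZ).
- by apply/set0Pn; exists (g z0); apply: imset_f.
- apply/independentP=> _ _ /imsetP[y yZ ->] /imsetP[z zZ ->] v.
  rewrite (g_edge y yZ).2 (g_edge z zZ).2 !inE.
  case/orP=> /eqP-> /orP[]/eqP eyz; first by rewrite eyz.
  + by have := (ZX y yZ).1; rewrite eyz fX.
  + by have := (ZX z zZ).1; rewrite -eyz fX.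
  by rewrite (f_inj y z).
move=> v /coveredP[z zZ [->{v}|->{v}]]; last by rewrite fX.
move=> zX e eG u ze ue uX; case: (endX e z u) => // [uD | uN].
  by right; rewrite (ZX z zZ).2 lt_max_degree.
left; have : u \in f @: Z by rewrite imf; apply/bigcupP; exists z.
case/imsetP=> y yZ ->; apply/bigcupP; exists (g y); first exact: imset_f.
by rewrite (g_edge y yZ).2 !inE eqxx orbT.
Qed.

(** One side has at least half of the vertices of maximal degree. Their neighbours of maximal degree
    lie on the other side, so [removable_of_hall] applies. *)
Lemma exists_removable X G : bipartite X G -> edges G != set0 ->
  exists M, removable X G M \/ removable (~: X) G M.
Proof.
move=> bipG G_n0; have [e0 e0G] := set0Pn _ G_n0.
have [x0 [_ [_ _ _]]] := bipartite_ends bipG e0G.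
have D_n0 : max_vertices G != set0.
  have [|x /eqP xmax] := @eq_bigmax V (degree G); first by apply/card_gt0P; exists x0.
  by apply/set0Pn; exists x; rewrite inE eq_sym.
have side Y : bipartite Y G ->
    #|max_vertices G :&: Y| <= #|max_vertices G :\: Y| -> exists M, removable Y G M.
  move=> bipY le_card; apply: (removable_of_hall (Z0 := max_vertices G :\: Y)) => //.
    rewrite -card_gt0; move: D_n0; rewrite -card_gt0 -(cardsID Y); lia.
  apply: leq_trans le_card; apply/subset_leq_card/bigcupsP=> z /setDP[_ zY].
  apply/subsetP=> u; rewrite inE => /andP[uD /exists_inP[e eG /eqP dee]].
  rewrite inE uD /=.
  have [x [y [de xY _]]] := bipartite_ends bipY eG.
  move: xY; have: x \in ends G e by rewrite de !inE eqxx.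
  by rewrite dee !inE => /orP[]/eqP-> //; rewrite (negPf zY).
have [le|lt] := leqP #|max_vertices G :&: X| #|max_vertices G :\: X|.
  by have [M] := side X bipG le; exists M; left.
have [|M] := side (~: X) (bipartiteC bipG).
  by rewrite -setDE (setDE _ (~: X)) setCK ltnW.
by exists M; right.
Qed.

(** * Preferences with small out-degree *)

(** The existential end expresses a bound by the larger degree of the two ends. *)
Definition galvin_coloring X G c : Prop :=
  proper_coloring G c /\
  {in edges G, forall e,
     exists2 v, v \in ends G e & outdegree G X c e < degree G v}.

(** Reversing the colours swaps the roles of the two sides. Subtracting from the maximum [K] keeps
    truncated subtraction injective. *)
Lemma galvin_coloringC X G c : galvin_coloring X G c ->
  exists c', galvin_coloring (~: X) G c'.
Proof.
case=> c_proper c_deg; pose K := \max_e c e.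
have leK e : c e <= K by apply: leq_bigmax.
exists (fun e => K - c e); split=> [e f eG fG v ve vf ef | e eG].
  by apply: (c_proper e f eG fG v) => //; have := leK e; have := leK f; lia.
have [v ve lt_v] := c_deg e eG; exists v => //; apply: leq_ltn_trans lt_v.
apply/subset_leq_card/subsetP=> f; rewrite !inE => /andP[-> /exists_inP[w wef]].
rewrite inE => lt_w; apply/exists_inP; exists w => //.
by move: lt_w; have := leK e; have := leK f; case: (w \in X) => /=; lia.
Qed.

(** Colour 0 puts [M] last on [X] and first elsewhere. So an edge of [M] is dominated only at its
    end in [X], and any other edge gains at most one out-neighbour, at its end outside [X]. *)
Lemma galvin_coloring_add X G M c : bipartite X G -> removable X G M ->
  galvin_coloring X (minus_edges G M) c -> exists c', galvin_coloring X G c'.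
Proof.
move=> bipG [sM _ indM closedM] [c_proper c_deg].
have MP := independentP _ _ indM.
pose c' e := if e \in M then 0 else (c e).+1.
have c'_proper : proper_coloring G c'.
  move=> e f eG fG v ve vf; rewrite /c'.
  case: ifPn => eM; case: ifPn => fM // ef; first exact: (MP e f eM fM v).
  apply: (c_proper e f _ _ v) => //; try by rewrite inE ?eM ?fM.
  by case: ef.
exists c'; split=> // e eG; have [eM | eM] := boolP (e \in M).
  have [x [y [de xX yX]]] := bipartite_ends bipG eG.
  have xe : x \in ends G e by rewrite de !inE eqxx.
  (* Strictness: [e] counts towards the degree of [x] but does not dominate itself. *)
  exists x => //; apply: proper_card; apply/properP; split; last first.
    exists e; first by rewrite inE eG.
    rewrite inE eG; apply/exists_inPn=> v _.
    by case: ifP; rewrite ltnn.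
  apply/subsetP=> f; rewrite !inE => /andP[-> /exists_inP[v /setIP[ve vf]]] /=.
  rewrite /c' eM; case: ifP => // vX _.
  suff <- : v = x by [].
  by apply: (bipartite_end_uniq bipG eG); rewrite // vX xX.
have [|v ve lt_v] := c_deg e; first by rewrite inE eM.
pose Q := [set f in M | [exists y in ends G e :&: ends G f, y \notin X]].
have out_le : outdegree G X c' e <= outdegree (minus_edges G M) X c e + #|Q|.
  apply: leq_trans (leq_card_setU _ _).
  apply/subset_leq_card/subsetP=> f; rewrite !inE => /andP[fG].
  case/exists_inP=> w wef; rewrite /c' (negPf eM) fG.
  have [fM | fM] /= := boolP (f \in M).
    by case: ifPn => // wX _; apply/exists_inP; exists w.
  by rewrite !ltnS => lt_w; apply/orP; left; apply/exists_inP; exists w.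
have degE w := degree_minus w sM indM.
have [Q0 | [f]] := set_0Vmem Q.
  exists v => //; rewrite degE; apply: leq_trans (leq_addr _ _).
  by apply: leq_ltn_trans lt_v; rewrite Q0 cards0 addn0 in out_le.
rewrite inE => /andP[fM /exists_inP[y /setIP[ye yf] yX]].
have Q1 : #|Q| <= 1.
  apply/card_le1_eqP=> g h.
  rewrite !inE => /andP[gM /exists_inP[v1 /setIP[v1e v1g] v1X]].
  case/andP=> hM /exists_inP[v2 /setIP[v2e v2h] v2X].
  apply: (MP h g hM gM v2) => //; suff -> : v2 = v1 by [].
  by apply: (bipartite_end_uniq bipG eG); rewrite // (negPf v1X) (negPf v2X).
(* The possible extra out-neighbour uses up the strictness of [lt_v]. *)
have {}out_le : outdegree G X c' e <= degree (minus_edges G M) v.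
  by apply: leq_trans out_le _; apply: leq_trans lt_v; rewrite -addn1 leq_add2l.
have y_cov : y \in covered G M by apply/bigcupP; exists f.
have [v_cov | v_ncov] := boolP (v \in covered G M).
  by exists v; rewrite // degE v_cov addn1 ltnS.
have vX : v \in X.
  apply: contraNT v_ncov => vX; suff -> : v = y by [].
  by apply: (bipartite_end_uniq bipG eG); rewrite // (negPf vX) (negPf yX).
(* Here [v] lies in [X] and is uncovered, so it keeps its degree; by [closedM] the degree of [y] is
   larger, and [y] replaces [v] as witness. *)
exists y => //; have [|lt_vy] := closedM y y_cov yX e eG v ye ve vX.
  by rewrite (negPf v_ncov).
by apply: leq_ltn_trans lt_vy; rewrite degE (negPf v_ncov) addn0.
Qed.

(** The induction is over all [X], since the removable matching may belong to the complementary
    side; reversing the colours then leads back. *)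
Lemma exists_galvin_coloring X G : bipartite X G ->
  exists c, galvin_coloring X G c.
Proof.
have [n] := ubnP #|edges G|; elim: n => // n IHn in X G * => /ltnSE leGn bipG.
have [G0 | G_n0] := eqVneq (edges G) set0.
  by exists (fun=> 0); split=> [e f | e]; rewrite G0 inE.
have step Y M : bipartite Y G -> removable Y G M -> exists c, galvin_coloring Y G c.
  move=> bipY remM; have [sM M_n0 _ _] := remM.
  have [||c cP] := IHn Y (minus_edges G M).
  - apply: leq_trans leGn; rewrite /= cardsDS //.
    by have := subset_leq_card sM; move: M_n0; rewrite -card_gt0; lia.
  - exact: bipartite_minus.
  exact: galvin_coloring_add remM cP.
have [M [remM|remM]] := exists_removable bipG G_n0; first exact: step remM.
have [c /galvin_coloringC] := step _ _ (bipartiteC bipG) remM.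
by rewrite setCK.
Qed.

(** * The bipartite bound and parallel play *)

Lemma bipartite_online_colorable X G t m : bipartite X G ->
  {in edges G, forall e v, v \in ends G e ->
     degree G v + \sum_(w in ends G e) t w <= m} ->
  online_colorable m G t.
Proof.
move=> bipG bound; have [c [c_proper c_deg]] := exists_galvin_coloring bipG.
apply: (kernel_perfect_colorable (dom := dominates G X c)) => [S sS | e eG].
  exact: stable_matching.
have [v ve lt_v] := c_deg e eG.
by apply: leq_trans (bound e eG v ve); rewrite -addSn leq_add2r.
Qed.

(** The summand [degree G1 v] pays for the rounds in which [v] is blocked in [G2]: each of them uses
    up an edge of [G1] at [v]. *)
Lemma online_colorable_union m G G1 G2 t1 t2 :
  ends G1 = ends G -> ends G2 = ends G -> edges G = edges G1 :|: edges G2 ->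
  [disjoint edges G1 & edges G2] -> (forall v, t2 v = t1 v + degree G1 v) ->
  online_colorable m G1 t1 -> online_colorable m G2 t2 ->
  online_colorable m G t1.
Proof.
elim: m G G1 G2 t1 t2 => [|m IHm] G G1 G2 t1 t2 ends1 ends2 edgesE dis12 t2E /=.
  by move=> /eqP G10 /eqP G20; rewrite edgesE G10 G20 setU0.
move=> /forall_inP col1 /forall_inP col2; apply/forall_inP=> U sU.
have /existsP[F1 /and3P[sF1 ind1 {}col1]] := col1 U sU.
have sF1G : F1 \subset edges G1.
  by apply: subset_trans sF1 _; apply/subsetP=> e /setIdP[].
have cov1U v : v \in covered G1 F1 -> v \notin U.
  case/bigcupP=> e eF ve; have := subsetP sF1 e eF; rewrite inE => /andP[_].
  by move=> /pred0P/(_ v) /=; rewrite ve => /= ->.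
(* A vertex covered by [F1] has positive degree in [G1], so [t2] allows it to be withheld from
   [G2]. *)
have sU2 : U :|: covered G1 F1 \subset supp t2.
  apply/subsetP=> v; rewrite !inE t2E (degree_minus v sF1G ind1).
  by case/orP=> [/(subsetP sU)|->]; rewrite ?inE; lia.
have /existsP[F2 /and3P[sF2 ind2 {}col2]] := col2 _ sU2.
have F2P e : e \in F2 -> [/\ e \in edges G2, [disjoint ends G e & U]
    & [disjoint ends G e & covered G1 F1]].
  move=> /(subsetP sF2); rewrite inE ends2 => /andP[-> dis].
  by split=> //; apply: disjointWr dis; rewrite ?subsetUl ?subsetUr.
have F12 e f v : e \in F1 -> f \in F2 -> v \in ends G e -> v \in ends G f -> False.
  move=> eF1 /F2P[_ _ dis] ve vf; have /pred0P/(_ v) := dis; rewrite /= vf.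
  by move=> /= /negP[]; apply/bigcupP; exists e; rewrite ?ends1.
apply/existsP; exists (F1 :|: F2); apply/and3P; split.
- rewrite subUset; apply/andP; split; apply/subsetP=> e.
    by move=> /(subsetP sF1); rewrite !inE ends1 edgesE inE => /andP[-> ->].
  by case/F2P=> eG dis _; rewrite inE edgesE inE eG orbT.
- apply/independentP=> e f; rewrite !inE => /orP[] eF /orP[] fF v ve vf.
  + by apply: (independentP _ _ ind1 e f eF fF v); rewrite ends1.
  + by case: (F12 e f v).
  + by case: (F12 f e v).
  by apply: (independentP _ _ ind2 e f eF fF v); rewrite ends2.
have sF2G : F2 \subset edges G2 by apply/subsetP=> e /F2P[].
apply: IHm col1 col2 => //=.
- apply/setP=> e; rewrite edgesE !inE.
  have /pred0P/(_ e) /= := dis12.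
  have /implyP := subsetP sF1G e; have /implyP := subsetP sF2G e.
  by do 4!case: (e \in _).
- by apply: disjointW dis12; apply: subsetDl.
(* The relation between [t2] and [t1] persists: at vertices covered by [F1], none of which is in
   [U], the degree drops by one; at those of [U], [t1] does. *)
move=> v; rewrite t2E (degree_minus v sF1G ind1) !inE.
have [/cov1U/negPf->|_] := boolP (v \in covered G1 F1).
  by rewrite addn1 addnS subn1 subn0.
rewrite orbF addn0 addnBAC //.
by have [/(subsetP sU)|] := boolP (v \in U); rewrite // inE lt0n.
Qed.

(** * Maximum cuts *)

Definition cut G X : {set E} := [set e in edges G | odd #|ends G e :&: X|].

Lemma exists_max_cut G : exists X, forall v,
  degree (minus_edges G (cut G X)) v <= degree (minus_edges G (edges G :\: cut G X)) v.
Proof.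
(* Moving [v] to the other side of a maximum cut does not enlarge it. *)
have [X _ maxX] := @arg_maxnP _ set0 xpredT (fun X => #|cut G X|) isT.
exists X => v; pose X' := [set w | (w \in X) (+) (w == v)].
have toggle e : e \in edges G ->
    odd #|ends G e :&: X'| = odd #|ends G e :&: X| (+) (v \in ends G e).
  move=> eG; have /eqP/cards2P[x [y [xy ->]]] := card_ends eG.
  rewrite !odd_card_pair // !inE ![v == _]eq_sym.
  have : ~~ ((x == v) && (y == v)).
    by apply: contraNN xy => /andP[/eqP-> /eqP->].
  by case: (x == v); case: (y == v); do 2!case: (_ \in X).
(* Only edges at [v] change status, so passing from [X] to [X'] exchanges the cut and uncut edges
   within [star]. *)
pose star := [set e | v \in ends G e].
have : #|cut G X'| <= #|cut G X| by apply: maxX.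
rewrite -(cardsID star (cut G X)) -(cardsID star (cut G X')).
have -> : cut G X' :\: star = cut G X :\: star.
  apply/setP=> e; rewrite !inE; have [ve|ve] //= := boolP (v \in ends G e).
  by case eG: (e \in edges G); rewrite //= toggle // (negPf ve) addbF.
rewrite leq_add2r /degree; congr (_ <= _); apply: eq_card => e; rewrite !inE /=.
  by case eG: (e \in edges G); rewrite //= toggle //; case: (v \in _); case: odd.
by case: (e \in edges G); rewrite //= ?andbF //; case: odd.
Qed.

Lemma degree_partition G F v : F \subset edges G ->
  degree G v = degree (minus_edges G F) v + degree (minus_edges G (edges G :\: F)) v.
Proof.
move=> sF; rewrite /degree /= setDDr setDv set0U (setIidPr sF).
rewrite -(cardsID F [set e in edges G | _]) addnC.
congr (_ + _); apply: eq_card => e; rewrite !inE -?andbA //.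
by case eF: (e \in F); rewrite ?andbF ?andbT // (subsetP sF).
Qed.

(** * The general bound *)

Lemma online_colorable_bound G t m :
  (forall u v, adjacent G u v ->
     maxn (degree G u) (degree G v) + (minn (degree G u) (degree G v)) %/ 2
       + t u + t v <= m) ->
  online_colorable m G t.
Proof.
have [n] := ubnP #|edges G|; elim: n => // n IHn in G t * => /ltnSE leGn bound.
have [X maxX] := exists_max_cut G.
set F := cut G X in maxX; set G1 := minus_edges G F in maxX.
set G2 := minus_edges G _ in maxX.
have sF : F \subset edges G by apply/subsetP=> e /setIdP[].
have degE v : degree G v = degree G1 v + degree G2 v by apply: degree_partition.
have col2 : online_colorable m G2 (fun v => t v + degree G1 v).
  apply: (@bipartite_online_colorable X) => [e | e].
    by case/setDP=> eG; rewrite !inE eG andbT negbK.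
  case/setDP=> eG _ w /=; have /eqP/cards2P[x [y [xy de]]] := card_ends eG.
  rewrite de !inE big_setU1 ?inE //= big_set1 => wxy.
  have adjxy : adjacent G x y by apply/exists_inP; exists e; rewrite ?de.
  (* At [w] the two parts of the degree add up to the full degree, and the other end contributes its
     degree in [G1], at most half of its degree by [maxX]. The sum fits the bound whichever end has
     the larger degree. *)
  have := bound x y adjxy; rewrite !degE.
  have := maxX x; have := maxX y; clear -wxy.
  by case/orP: wxy => /eqP->; lia.
have [F0 | F_n0] := eqVneq F set0; last first.
  apply: (online_colorable_union (G1 := G1) (G2 := G2) _ _ _ _ _ _ col2) => //=.
  - by rewrite setDDr setDv set0U (setIidPr sF) setUC -{1}(setIidPr sF) setID.
  - by apply/pred0P=> e; rewrite /= !in_setD; case: (e \in F); case: (e \in edges G).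
  apply: IHn => [|u v uv].
    apply: leq_trans leGn; rewrite /= cardsDS //.
    by have := subset_leq_card sF; move: F_n0; rewrite -card_gt0; clear; lia.
  have adjuv : adjacent G u v.
    have /exists_inP[e /setDP[eG _] de] := uv.
    by apply/exists_inP; exists e.
  have := bound u v adjuv; have := degE u; have := degE v; clear; lia.
(* With an empty cut, [maxX] forces every degree to be zero, so there are no edges. *)
have G2E : edges G2 = set0 by rewrite /= F0 setD0 setDv.
have deg0 v : degree G v = 0.
  have : degree G2 v = 0.
    by apply/eqP; rewrite cards_eq0 -subset0; apply/subsetP=> e; rewrite inE G2E !inE.
  by have := maxX v; rewrite degE; lia.
apply: (@bipartite_online_colorable X) => [e|e] eG; exfalso;
  have /eqP/cards2P[x [y [xy de]]] := card_ends eG;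
  have := degree_gt0 (u := x) eG; by rewrite de deg0 !inE eqxx => /(_ isT).
Qed.

End Galvin.

Theorem theorem3p3 (V E : finType) (G : multigraph V E) (t : V -> nat) :
  online_chromatic_index G t <=
    \max_(u : V) \max_(v : V | adjacent G u v)
      (maxn (degree G u) (degree G v)
       + (minn (degree G u) (degree G v)) %/ 2 + t u + t v)
  /\
  (forall c : nat, (forall v : V, t v = c) ->
     online_chromatic_index G t <= (3 * max_degree G) %/ 2 + 2 * c).
Proof.
have index_le m : online_colorable m G t -> online_chromatic_index G t <= m.
  by rewrite /online_chromatic_index; case: ex_minnP => k _; apply.
split=> [|c tc]; apply/index_le/online_colorable_bound => u v uv.
  apply: leq_trans (leq_bigmax u).
  exact: (leq_bigmax_cond v uv).
(* For the maximal degree [D], [D + D %/ 2] equals [(3 * D) %/ 2]. *)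
have /= := @leq_bigmax V (degree G) u; have /= := @leq_bigmax V (degree G) v.
by rewrite -/(max_degree G) !tc; clear; lia.
Qed.
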